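(* Let $(\mathscr{X}_i,\rho_i)$, $i=1,2$, be metric spaces, let $\rho_3((u,x),(v,y))=\max\{\rho_1(u,v),\rho_2(x,y)\}$ on $\mathscr{X}_1\times\mathscr{X}_2$, and let $G_i\subset\mathscr{X}_i$, $i=1,2$. Let $\alpha>0$ and assume that $G_1$ is a $\gamma_1$-Ahlfors-David regular set. (i) If $\gamma_1\le\alpha$, then there is a constant $\mathfrak{c}_7>0$ such that $\mathcal{C}_{\rho_2}^{\alpha-\gamma_1}(G_2)\le\mathfrak{c}_7\,\mathcal{C}_{\rho_3}^{\alpha}(G_1\times G_2)$. (ii) If $\gamma_1<\alpha$, then there is a constant $\mathfrak{c}_8>0$ such that $\mathcal{H}_{\rho_3}^{\alpha}(G_1\times G_2)\le\mathfrak{c}_8\,\mathcal{H}_{\rho_2}^{\alpha-\gamma_1}(G_2)$. Similar estimates hold if instead $G_2$ is a $\gamma_2$-Ahlfors-David regular set: there are positive constants $\mathfrak{c}_9,\mathfrak{c}_{10}$ such that $\mathcal{C}_{\rho_1}^{\alpha-\gamma_2}(G_1)\le\mathfrak{c}_9\,\mathcal{C}_{\rho_3}^{\alpha}(G_1\times G_2)$ if $\gamma_2\le\alpha$, and $\mathcal{H}_{\rho_3}^{\alpha}(G_1\times G_2)\le\mathfrak{c}_{10}\,\mathcal{H}_{\rho_1}^{\alpha-\gamma_2}(G_1)$ if $\gamma_2<\alpha$.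
   Context: A set $G\subset(\mathscr{X},\rho)$ is $\gamma$-Ahlfors-David regular ($\gamma>0$) if there exist a finite positive Borel measure $\mu$ supported on $G$ and a constant $\mathfrak{c}_\gamma>0$ with $\mathfrak{c}_\gamma^{-1}r^\gamma\le\mu(B_\rho(a,r))\le\mathfrak{c}_\gamma r^\gamma$ for all $a\in G$ and all $0<r\le1$, where $B_\rho(a,r)$ is the open ball. For $G\subset(\mathscr{X},\rho)$ and $\beta>0$, $\mathcal{H}_\rho^\beta(G)=\lim_{\delta\to0}\inf\{\sum_{n}(2r_n)^\beta: G\subseteq\bigcup_{n} B_\rho(r_n),\ r_n\le\delta\}$, where $B_\rho(r)$ denotes an open ball of radius $r$. For $\beta\ge0$, $\mathcal{C}_\rho^\beta(G)=\big[\inf_{\mu\in\mathcal{P}(G)}\iint\varphi_\beta(\rho(u,v))\mu(du)\mu(dv)\big]^{-1}$, where $\mathcal{P}(G)$ is the set of (Borel) probability measures carried by $G$, $\varphi_\beta(r)=r^{-\beta}$ if $\beta>0$ and $\varphi_0(r)=\log\left(\frac{e}{r\wedge1}\right)$ (with $\varphi_\beta(0)=\infty$, $1/\infty=0$, $\inf\emptyset=\infty$). *)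

(* Defs.v *)
From HB Require Import structures.
From mathcomp Require Import all_boot all_order all_algebra.
From mathcomp Require Import all_classical all_reals all_analysis.

Set Implicit Arguments.
Unset Strict Implicit.
Unset Printing Implicit Defensive.

Import Order.TTheory GRing.Theory Num.Theory.
Import numFieldNormedType.Exports.

Local Open Scope classical_set_scope.
Local Open Scope ring_scope.

(* The library's [measurableType]s are pointed, so metric spaces carrying Borel
   measures are taken to be nonempty. *)
#[short(type="pmetricType")]
HB.structure Definition PMetric (R : numDomainType) :=
  {X of Metric R X & Pointed X}.

Section product_metric.
Context {R : realType} (X Y : metricType R).
Implicit Types p q : X * Y.

Definition max_mdist p q : R := Num.max (mdist p.1 q.1) (mdist p.2 q.2).

Let max_mdist_ge0 p q : 0 <= max_mdist p q.
Proof. by rewrite le_max mdist_ge0. Qed.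

Let max_mdist_positivity p q : max_mdist p q = 0 -> p = q.
Proof.
case: p q => [u x] [v y] /= d0.
have [du dx] : mdist u v <= 0 /\ mdist x y <= 0.
  by rewrite -d0 /max_mdist /= !le_max !lexx orbT.
by congr pair; apply: mdist_positivity; apply/eqP;
  rewrite eq_le mdist_ge0 andbT.
Qed.

Let ball_max_mdist p r : ball p r = [set q | max_mdist p q < r].
Proof.
apply/seteqP; split=> q; rewrite /ball /= /prod_ball /max_mdist !ballEmdist /=.
  by case=> ? ?; rewrite gt_max; apply/andP.
by rewrite gt_max => /andP.
Qed.

(* The library equips [X * Y] with the products of balls, i.e. with the balls of
   the maximum metric. *)
HB.instance Definition _ := PseudoMetric_isMetric.Build R (X * Y)%type
  max_mdist_ge0 max_mdist_positivity ball_max_mdist.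

End product_metric.

HB.instance Definition _ (R : realType) (X Y : pmetricType R) :=
  Metric.on (X * Y)%type.

Definition borel {R : realType} (X : pmetricType R) :=
  g_sigma_algebraType (@open X).

Section regularity_capacity_measure.
Context {R : realType} (X : pmetricType R).
Implicit Types (G : set X) (beta gamma delta : R).
Local Open Scope ereal_scope.

(* [G] need not be Borel: a measure is carried by [G] when the complement of [G]
   is contained in a Borel null set. *)
Definition carried_by (mu : set (borel X) -> \bar R) G :=
  mu.-negligible (~` G).

(* A positive measure is a nonzero one; hence a regular set is nonempty. *)
Definition ahlfors_david_regular gamma G :=
  exists (mu : {finite_measure set (borel X) -> \bar R}) (c : R),
    [/\ 0 < mu [set: X], carried_by mu G, (0 < c)%R
      & forall (a : X) (r : R), G a -> (0 < r <= 1)%R ->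
          (c^-1 * r `^ gamma)%:E <= mu (ball a r) <= (c * r `^ gamma)%:E].

(* Radius 0 is allowed: such a ball is empty and contributes 0 to the sum when
   [beta > 0], so finite covers are included. *)
Definition hausdorff_content beta delta G : \bar R :=
  ereal_inf [set s | exists (a : nat -> X) (r : nat -> R),
    [/\ forall n, (0 <= r n <= delta)%R,
        G `<=` \bigcup_n ball (a n) (r n)
      & s = \sum_(n <oo) ((2 * r n) `^ beta)%:E]].

Definition hausdorff_measure beta G : \bar R :=
  lim (hausdorff_content beta delta G @[delta --> 0%R^'+]).

Definition riesz_kernel beta (r : R) : \bar R :=
  if r == 0%R then +oo
  else if (0 < beta)%R then (r `^ (- beta))%:E
  else (ln (expR 1 / Num.min r 1))%:E.

Definition energy beta (mu : set (borel X) -> \bar R) : \bar R :=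
  \int[mu]_(v in [set: borel X]) \int[mu]_(u in [set: borel X])
    riesz_kernel beta (mdist (u : X) (v : X)).

(* [inve] satisfies [0^-1 = +oo] and [+oo^-1 = 0]. *)
Definition capacity beta G : \bar R :=
  (ereal_inf [set energy beta mu
    | mu in [set mu : probability (borel X) R | carried_by mu G]])^-1.

End regularity_capacity_measure.

Section sanity.
Context {R : realType}.
Local Open Scope ereal_scope.

Lemma mdist_prodE (X Y : metricType R) (p q : X * Y) :
  mdist p q = Num.max (mdist p.1 q.1) (mdist p.2 q.2).
Proof. by []. Qed.

Lemma hausdorff_content_le (X : pmetricType R) (beta d1 d2 : R) (G : set X) :
  (d1 <= d2)%R -> hausdorff_content beta d2 G <= hausdorff_content beta d1 G.
Proof.
move=> d12; apply: ereal_inf_le_tmp => _ [a [r [r_d Gr ->]]].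
exists a, r; split=> // n; have /andP[-> /= rn] := r_d n.
exact: le_trans rn d12.
Qed.

Lemma hausdorff_content_cvg (X : pmetricType R) (beta : R) (G : set X) :
  cvg (hausdorff_content beta delta G @[delta --> 0%R^'+]).
Proof.
apply: (@nonincreasing_at_right_is_cvge _ _ 0%R).
near=> y => d1 d2 _ _; exact: hausdorff_content_le.
Unshelve. all: by end_near.
Qed.

End sanity.

(* Main.v *)
(* Capacity. Let [P] be the normalized regular measure on [G1] and [nu] a
   probability carried by [G2]. Splitting [{u | rho1 u v < 2 d}] from its
   complement, the integral [I d] of [phi_alpha (max (rho1 u v) d)] against [P]
   satisfies [I d <= A d^(gamma - alpha) + I (2 d)], so that [I d] is at most a
   constant times [phi_(alpha - gamma) d], uniformly in [v]. Integrating over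
   [nu] in both variables compares the energy of [P x nu] with that of [nu].
   The product measure lives on the product of the two Borel sigma-algebras,
   which may be smaller than the Borel sigma-algebra of the product. However
   [G1] is totally bounded, so [P] is carried by a separable Borel set [S], and
   [(u, x) |-> (u, x)], with [u] sent to a fixed point of [S] when [u] is outside
   [S], is Borel; the measure used is the image of [P x nu] by this map.

   Hausdorff measure. For [r <= 1], comparing masses of disjoint balls shows that
   [G1] is covered by at most [C r^(-gamma)] balls of radius [r]. A cover of [G2]
   by balls of radii [r n] therefore gives a cover of the product with
   [C (r n)^(-gamma)] balls of radius [r n] for each [n]. *)

From HB Require Import structures.
Require Import Defs.
From mathcomp Require Import all_boot all_order all_algebra.
From mathcomp Require Import all_classical all_reals all_analysis.
From mathcomp Require Import measurable_realfun ring lra.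

Set Implicit Arguments.
Unset Strict Implicit.
Unset Printing Implicit Defensive.

Import Order.TTheory GRing.Theory Num.Theory.
Import numFieldNormedType.Exports.

Local Open Scope classical_set_scope.
Local Open Scope ring_scope.

(** * Borel sets and the Riesz kernel *)

Section borel_measurability.
Context {R : realType} (X : pmetricType R).

Lemma open_ballP (U : set X) :
  (forall x, U x -> exists2 e : R, 0 < e & ball x e `<=` U) -> open U.
Proof.
move=> Ue; rewrite openE => x /Ue[e e0 xeU].
by rewrite /interior -nbhs_ballE; exists e.
Qed.

Lemma open_ball (x : X) (r : R) : open (ball x r).
Proof.
apply: open_ballP => y; rewrite ballEmdist /= => xy.
exists (r - mdist x y); first by rewrite subr_gt0.
move=> z; rewrite !ballEmdist /= => yz.
by rewrite (le_lt_trans (metric_triangle x y z))// -ltrBrDl.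
Qed.

Lemma borel_open (U : set X) : open U -> measurable (U : set (borel X)).
Proof. by move=> oU; apply: sub_sigma_algebra. Qed.

Lemma borel_ball (x : X) (r : R) : measurable (ball x r : set (borel X)).
Proof. by apply: borel_open; exact: open_ball. Qed.

Lemma measurable_mdistr (v : X) :
  measurable_fun [set: borel X] (fun u : borel X => mdist (u : X) v).
Proof.
apply: (measurability _ (@RGenInftyO.measurableE R)) => _ [_ [a ->] <-].
rewrite setTI (_ : _ @^-1` _ = ball v a); first exact: borel_ball.
by apply/seteqP; split=> u; rewrite ballEmdist /= in_itv /= metric_sym.
Qed.

End borel_measurability.

Lemma measurable_continuous {R : realType} (X Y : pmetricType R) (f : X -> Y) :
  continuous f -> measurable_fun [set: borel X] (f : borel X -> borel Y).
Proof.
move=> /continuousP cf.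
apply: (@measurability _ _ (borel X) (borel Y) _ _ (@open Y)) => //.
by move=> _ [U oU <-]; rewrite setTI; by apply: borel_open; exact: cf.
Qed.

Section riesz_kernel_theory.
Context {R : realType} (beta : R).
Local Open Scope ereal_scope.

Lemma riesz_kernel_ge0 (r : R) : 0 <= riesz_kernel beta r.
Proof.
rewrite /riesz_kernel; case: ifPn => // r0.
case: ifPn => _; rewrite lee_fin ?powR_ge0//.
have [r_gt0|r_le0] := ltP 0%R r.
  have m0 : (0 < Num.min r 1)%R by rewrite lt_min r_gt0 ltr01.
  rewrite ln_ge0// ler_pdivlMr// mul1r (le_trans (_ : _ <= 1)%R)//.
    by rewrite ge_min lexx orbT.
  by rewrite -[leLHS]expR0 ler_expR.
(* For [r <= 0] the argument of [ln] is nonpositive, where [ln] is 0 by convention. *)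
rewrite ln0// pmulr_rle0 ?expR_gt0// invr_le0.
by rewrite ge_min r_le0.
Qed.

Lemma riesz_kernelE (r : R) : (0 < r)%R -> riesz_kernel beta r =
  (if 0 < beta then r `^ (- beta) else 1 - ln (Num.min r 1))%R%:E.
Proof.
move=> r0; rewrite /riesz_kernel gt_eqF//; case: ifPn => // _.
by rewrite ln_div ?posrE ?expR_gt0// ?expRK// lt_min r0 ltr01.
Qed.

Lemma riesz_kernel_le (r s : R) : (0 <= r <= s)%R ->
  riesz_kernel beta s <= riesz_kernel beta r.
Proof.
move=> /andP[]; rewrite le_eqVlt => /predU1P[<- _|r0 rs].
  by rewrite {2}/riesz_kernel eqxx leey.
have s0 : (0 < s)%R by exact: lt_le_trans rs.
rewrite !riesz_kernelE// lee_fin; case: ifPn => b.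
  rewrite !powRN lef_pV2 ?posrE ?powR_gt0//.
  by apply: ge0_ler_powR; rewrite ?nnegrE// ltW.
rewrite lerD2l lerN2 ler_ln ?posrE ?lt_min ?r0 ?s0 ?ltr01//.
by rewrite le_min !ge_min rs lexx orbT.
Qed.

(** The kernel is inverted explicitly: in the main cases [s0] is the threshold below which it
    exceeds [t], and the midpoint of [r] and [s0] serves. The value [+oo] at [r = 0] is included. *)
Lemma riesz_kernel_lsc (r t : R) : (0 <= r)%R -> t%:E < riesz_kernel beta r ->
  exists2 s : R, (r < s)%R & t%:E < riesz_kernel beta s.
Proof.
move=> r0 tr; have [b|b] := boolP (0 < beta)%R.
  have [t0|t0] := leP t 0%R.
    exists (r + 1)%R; first by rewrite ltrDl.
    have s0 : (0 < r + 1)%R by rewrite ltr_wpDl.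
    by rewrite riesz_kernelE// b lte_fin (le_lt_trans t0)// powR_gt0.
  pose s0 := (t `^ (- beta^-1))%R.
  have s0_gt0 : (0 < s0)%R by rewrite powR_gt0.
  have ts0 : (s0 `^ (- beta) = t)%R.
    by rewrite -powRrM mulrNN mulVf ?gt_eqF// powRr1// ltW.
  have lts (s : R) : (0 < s < s0)%R -> (t < s `^ (- beta))%R.
    move=> /andP[s_gt0 ss0]; rewrite -ts0 !powRN ltf_pV2 ?posrE ?powR_gt0//.
    by apply: gt0_ltr_powR; rewrite ?nnegrE// ltW.
  have rs0 : (r < s0)%R.
    move: r0; rewrite le_eqVlt => /predU1P[<-//|r0].
    move: tr; rewrite riesz_kernelE// b lte_fin; apply: contra_ltT; rewrite -leNgt => s0r.
    rewrite -[leRHS]ts0 !powRN lef_pV2 ?posrE ?powR_gt0//.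
    by apply: ge0_ler_powR; rewrite ?nnegrE// ltW.
  exists ((r + s0) / 2)%R; first lra.
  rewrite riesz_kernelE; last lra.
  by rewrite b lte_fin lts//; apply/andP; split; lra.
pose s0 := expR (1 - t)%R.
have lts (s : R) : (0 < s)%R -> (Num.min s 1 < s0)%R -> t%:E < riesz_kernel beta s.
  move=> s_gt0 ss0; rewrite riesz_kernelE// (negbTE b) lte_fin.
  suff : (ln (Num.min s 1) < 1 - t)%R by lra.
  by rewrite -(expRK (1 - t)%R) ltr_ln ?posrE ?expR_gt0// lt_min s_gt0 ltr01.
have rs0 : (Num.min r 1 < s0)%R.
  move: r0; rewrite le_eqVlt => /predU1P[<-|r0].
    by rewrite gt_min expR_gt0.
  move: tr; rewrite riesz_kernelE// (negbTE b) lte_fin => tr.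
  rewrite -[ltLHS]lnK ?posrE ?lt_min ?r0 ?ltr01// ltr_expR; lra.
have [rs|s0r] := ltP r s0.
  exists ((r + s0) / 2)%R; first lra.
  by apply: lts; [lra|rewrite gt_min; apply/orP; left; lra].
(* Here [Num.min r 1 < s0 <= r] forces [1 < s0], hence [t < 1], and the logarithmic kernel is
   constantly 1 from radius 1 on. *)
exists (r + 1)%R; first lra.
apply: lts; first lra.
by move: rs0; rewrite !gt_min (ltNge r) s0r /= => ->; rewrite orbT.
Qed.

Lemma measurable_riesz_kernel : measurable_fun [set: R] (riesz_kernel beta).
Proof.
have -> : riesz_kernel beta = fun r : R => if r == 0%R then +oo else
    (if 0 < beta then r `^ (- beta)
     else if 0 < r then 1 - ln (Num.min r 1) else 0)%R%:E.
  apply/funext => r; have [r0|r0] := ltP 0%R r.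
    by rewrite riesz_kernelE// gt_eqF.
  rewrite /riesz_kernel; case: ifPn => // _; case: ifPn => // _.
  by rewrite ln0// pmulr_rle0 ?expR_gt0// invr_le0 ge_min r0.
apply: measurable_fun_ifT => //=; first exact: measurable_fun_eqr.
apply/measurable_EFinP; case: (0 < beta)%R => /=; first exact: measurable_powR.
apply: measurable_fun_ifT => //=; first exact: measurable_fun_ltr.
apply: measurable_funB => //; apply: (measurableT_comp (@measurable_ln R)).
exact: measurable_minr.
Qed.

End riesz_kernel_theory.

(** The values increase by monotonicity, and a supremum below the kernel at [r] would contradict
    [riesz_kernel_lsc]. *)
Lemma riesz_kernel_cvg {R : realType} (beta r : R) : 0 <= r ->
  riesz_kernel beta (r + n.+1%:R^-1) @[n --> \oo] --> riesz_kernel beta r.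
Proof.
move=> r0.
have nd : {homo (fun n => riesz_kernel beta (r + n.+1%:R^-1)) :
    m n / (m <= n)%N >-> (m <= n)%E}.
  move=> m n mn; apply: riesz_kernel_le.
  rewrite addr_ge0 ?invr_ge0//= lerD2l lef_pV2 ?posrE ?ltr0n//.
  by rewrite ler_nat.
have /cvg_trans := ereal_nondecreasing_cvgn nd; apply.
set s := ereal_sup _.
suff -> : s = riesz_kernel beta r by [].
have s0 : (0 <= s)%E.
  apply: le_trans (riesz_kernel_ge0 beta (r + 1%:R^-1)) _.
  by apply: ereal_sup_ubound; exists 0%N.
apply/eqP; rewrite eq_le; apply/andP; split.
  apply: ge_ereal_sup => _ [n _ <-]; apply: riesz_kernel_le.
  by rewrite r0 lerDl invr_ge0 ler0n.
rewrite leNgt; apply/negP => sr.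
have sfin : s \is a fin_num.
  by rewrite ge0_fin_numE// (lt_le_trans sr)// leey.
have [t rt st] : exists2 t, r < t & (s < riesz_kernel beta t)%E.
  by move: sr; rewrite -(fineK sfin) => /(riesz_kernel_lsc r0).
have [n nt] : exists n, n.+1%:R^-1 < t - r.
  by exists (Num.truncn (t - r)^-1); rewrite invf_plt ?posrE ?subr_gt0 ?truncnS_gt.
have : (riesz_kernel beta t <= s)%E.
  apply: (@le_trans _ _ (riesz_kernel beta (r + n.+1%:R^-1))).
    apply: riesz_kernel_le; by rewrite addr_ge0 ?invr_ge0 ?ler0n//= -lerBrDl ltW.
  by apply: ereal_sup_ubound; exists n.
by rewrite leNgt st.
Qed.

(** * Potentials of measures *)

Section potential.
Context {R : realType} (X : pmetricType R) (beta : R).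
Variable mu : {measure set (borel X) -> \bar R}.
Local Open Scope ereal_scope.

Lemma measurable_riesz_mdist (v : X) (a : R) : measurable_fun [set: borel X]
  (fun u : borel X => riesz_kernel beta (mdist (u : X) v + a)).
Proof.
apply: (measurableT_comp (measurable_riesz_kernel beta)).
by apply: measurable_funD => //; exact: measurable_mdistr.
Qed.

Lemma potential_shift_cvg (v : X) :
  \int[mu]_(u in [set: borel X])
    riesz_kernel beta (mdist (u : X) v + n.+1%:R^-1) @[n --> \oo] -->
  \int[mu]_(u in [set: borel X]) riesz_kernel beta (mdist (u : X) v).
Proof.
rewrite (_ : \int[mu]_(u in [set: borel X]) _ =
    \int[mu]_(u in [set: borel X])
      limn (fun n => riesz_kernel beta (mdist (u : X) v + n.+1%:R^-1))); last first.
  apply: eq_integral => u _; apply/esym/cvg_lim => //.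
  exact/riesz_kernel_cvg/mdist_ge0.
apply: cvg_monotone_convergence => //.
- by move=> n; exact: measurable_riesz_mdist.
- by move=> n u _; exact: riesz_kernel_ge0.
- move=> u _ m n mn; apply: riesz_kernel_le.
  rewrite addr_ge0 ?invr_ge0 ?mdist_ge0//= lerD2l lef_pV2 ?posrE ?ltr0n//.
  by rewrite ler_nat.
Qed.

(* The potential is lower semicontinuous: the potentials of the kernels shifted
   by [n.+1%:R^-1] increase to it, and the shift absorbs a displacement of [v]
   by less than [n.+1%:R^-1]. *)
Lemma measurable_potential : measurable_fun [set: borel X] (fun v : borel X =>
  \int[mu]_(u in [set: borel X]) riesz_kernel beta (mdist (u : X) (v : X))).
Proof.
apply: (measurability _ (@ErealGenOInfty.measurableE R)) => _ [_ [a ->] <-].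
rewrite setTI preimage_itvoy; apply: borel_open.
apply: open_ballP => v /= av.
have [n an] : exists n, a%:E < \int[mu]_(u in [set: borel X])
    riesz_kernel beta (mdist (u : X) v + n.+1%:R^-1).
  apply: contrapT => /forallNP an; move: av; apply/negP; rewrite -leNgt.
  have vcvg := @potential_shift_cvg v.
  rewrite -(cvg_lim _ vcvg)//; apply: lime_le.
    by apply/cvg_ex; eexists; exact: vcvg.
  by apply: nearW => n; rewrite leNgt; exact/negP/an.
exists n.+1%:R^-1%R; first by rewrite invr_gt0.
move=> w; rewrite ballEmdist /= => vw; apply: (lt_le_trans an).
apply: ge0_le_integral => //.
- by move=> u _; exact: riesz_kernel_ge0.
- exact: measurable_riesz_mdist.
- by have := measurable_riesz_mdist w 0; under eq_fun do rewrite addr0.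
- move=> u _; apply: riesz_kernel_le; rewrite mdist_ge0/=.
  by rewrite (le_trans (metric_triangle _ v _))// lerD2l ltW.
Qed.

End potential.

(** * Regular measures *)

Section doubling_recursion.
Context {R : realType} (J : R -> R) (A alpha : R).
Hypotheses (A_ge0 : 0 <= A) (alpha_gt0 : 0 < alpha).
Hypothesis J_le : forall d, 0 < d -> J d <= d `^ (- alpha).

(** Iterating along [d], [2 d], [4 d], ... gives a geometric series of ratio [q < 1], and the
    remainder, at most [(2^n d)^(-alpha)], tends to 0. *)
Lemma doubling_powR (s d : R) : 0 < s ->
  (forall d, 0 < d -> J d <= A * d `^ (- s) + J (2 * d)) -> 0 < d ->
  J d <= A / (1 - 2 `^ (- s)) * d `^ (- s).
Proof.
move=> s0 JD d0; set q := 2 `^ (- s); set C := A / _.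
have q1 : q < 1.
  rewrite /q powRN invf_lt1 ?powR_gt0//.
  have : 1 `^ s < (2 : R) `^ s by apply: gt0_ltr_powR; rewrite ?nnegrE; lra.
  by rewrite powR1.
(* This fixed-point equation lets the induction step reproduce the same constant. *)
have CE : C = A + C * q by rewrite /C; field; lra.
have Jn (n : nat) (e : R) : 0 < e -> J e <= C * e `^ (- s) + (e * 2 ^+ n) `^ (- alpha).
  elim: n e => [|n IHn] e e0.
    rewrite expr0 mulr1 (le_trans (J_le e0))// lerDr mulr_ge0 ?powR_ge0//.
    by rewrite divr_ge0//; lra.
  have := IHn (2 * e); rewrite mulr_gt0// => /(_ isT) J2e.
  apply: le_trans (JD _ e0) _; apply: le_trans (lerD (lexx _) J2e) _.
  rewrite (_ : 2 * e * 2 ^+ n = e * 2 ^+ n.+1); last by rewrite exprS; ring.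
  rewrite (@powRM _ 2 e) ?(ltW e0)// -/q addrA.
  rewrite lerD2r [in leRHS]CE.
  by rewrite mulrDl -mulrA.
(* [b] solves [b^(-alpha) = e], so the remainder is at most [e] once [2^n d] exceeds [b]. *)
apply/ler_addgt0Pr => e e0; pose b := e `^ (- alpha^-1).
have b0 : 0 < b by rewrite powR_gt0.
pose n := (Num.truncn (b / d)).+1.
apply: le_trans (Jn n d d0) _; rewrite lerD2l.
have -> : e = b `^ (- alpha).
  by rewrite -powRrM mulrNN mulVf ?gt_eqF// powRr1// ltW.
have bd : b <= d * 2 ^+ n.
  rewrite -ler_pdivrMl// mulrC (le_trans (ltW (truncnS_gt _)))//.
  by rewrite -natrX ler_nat ltnW// ltn_expl.
rewrite !powRN lef_pV2 ?posrE ?powR_gt0//; last exact: lt_le_trans bd.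
by apply: ge0_ler_powR; rewrite // ?nnegrE ltW// (lt_le_trans b0).
Qed.

(** In the critical case each doubling costs [A], and about [- ln d / ln 2] doublings bring [d]
    close to 1, where [J] is at most 1. *)
Lemma doubling_ln (d : R) :
  (forall d, 0 < d -> J d <= A + J (2 * d)) -> 0 < d <= 1 ->
  J d <= A + 1 - A / ln 2 * ln d.
Proof.
move=> JD /andP[d0 d1].
have ln2 : 0 < ln 2 :> R by apply: ln_gt0; lra.
have Jn (n : nat) (e : R) : 0 < e <= 1 -> 1 <= e * 2 ^+ n ->
    J e <= A + 1 - A / ln 2 * ln e.
  elim: n e => [|n IHn] e /andP[e0 e1].
    rewrite mulr1 => e1'; have -> : e = 1 by apply/eqP; rewrite eq_le e1 e1'.
    by rewrite ln1 mulr0 subr0 (le_trans (J_le ltr01))// powR1 lerDr.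
  move=> en; apply: le_trans (JD _ e0) _.
  (* The induction hypothesis applies while [2 * e <= 1]; beyond that, [J_le] already gives
     [J (2 * e) <= 1]. *)
  have [e2|e2] := leP e 2^-1.
    have /IHn : 0 < 2 * e <= 1 by apply/andP; split; lra.
    rewrite (_ : 2 * e * 2 ^+ n = e * 2 ^+ n.+1); last by rewrite exprS; ring.
    move=> /(_ en); rewrite lnM ?posrE//.
    rewrite (_ : A / ln 2 * (ln 2 + ln e) = A + A / ln 2 * ln e).
      by move: (A / _ * _) => t ?; lra.
    by rewrite mulrDr divfK// gt_eqF.
  have e2_gt0 : 0 < 2 * e by rewrite mulr_gt0.
  have : J (2 * e) <= 1.
    rewrite (le_trans (J_le e2_gt0))// powRN invf_le1 ?powR_gt0//.
    have : 1 `^ alpha <= (2 * e) `^ alpha.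
      by apply: ge0_ler_powR; rewrite ?nnegrE ?(ltW alpha_gt0)//; lra.
    by rewrite powR1.
  suff : A / ln 2 * ln e <= 0 by move: (A / _ * _) => t ? ?; lra.
  by rewrite mulr_ge0_le0 ?divr_ge0 ?ln_le0// ltW.
apply: (Jn (Num.truncn d^-1).+1); first by rewrite d0.
rewrite -ler_pdivrMl// mulr1 (le_trans (ltW (truncnS_gt _)))//.
by rewrite -natrX ler_nat ltnW// ltn_expl.
Qed.

End doubling_recursion.

(** * Truncated kernel integrals against a measure of growth [r^gamma] *)

Section kernel_bound.
Context {R : realType} (X : pmetricType R) (mu : probability (borel X) R).
Variables (alpha gamma K : R).
Hypotheses (alpha_gt0 : 0 < alpha) (K_ge0 : 0 <= K).
Hypothesis mu_ball : forall (v : X) (r : R), 0 < r ->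
  (mu (ball v r) <= (K * r `^ gamma)%:E)%E.
Local Open Scope ereal_scope.

(** The maximum with [d] is the distance in the product when the second coordinates are [d] apart;
    it also makes the integral finite for [0 < d]. *)
Let I (v : X) (d : R) := \int[mu]_(u in [set: borel X])
  riesz_kernel alpha (Num.max (mdist (u : X) v) d).

Let mI (v : X) (d : R) : measurable_fun [set: borel X]
  (fun u : borel X => riesz_kernel alpha (Num.max (mdist (u : X) v) d)).
Proof.
apply: (measurableT_comp (measurable_riesz_kernel alpha)).
by apply: measurable_maxr => //; exact: measurable_mdistr.
Qed.

Let I_le (v : X) (d : R) : (0 < d)%R -> I v d <= (d `^ (- alpha))%:E.
Proof.
move=> d0; rewrite -[leRHS]mule1 -(probability_setT mu).
rewrite -integral_cst//; apply: ge0_le_integral => //.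
- by move=> u _; exact: riesz_kernel_ge0.
- move=> u _; rewrite (_ : (_ `^ _)%:E = riesz_kernel alpha d); last first.
    by rewrite riesz_kernelE// alpha_gt0.
  by apply: riesz_kernel_le; rewrite ltW//= le_max lexx orbT.
Qed.

(** Outside [ball v (2 * d)] both truncations leave the distance unchanged. Inside, the kernel is at
    most [d^(-alpha)] and the mass at most [K (2 d)^gamma]. *)
Let I_double (v : X) (d : R) : (0 < d)%R ->
  I v d <= (K * 2 `^ gamma * d `^ (- (alpha - gamma)))%:E + I v (2 * d)%R.
Proof.
move=> d0; have dd0 : (0 < 2 * d)%R by rewrite mulr_gt0.
apply: (@le_trans _ _ (\int[mu]_(u in [set: borel X])
    ((d `^ (- alpha))%:E * (\1_(ball v (2 * d)%R : set (borel X)) u)%:E +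
     riesz_kernel alpha (Num.max (mdist (u : X) v) (2 * d)%R)))).
  apply: ge0_le_integral => //.
  - by move=> u _; exact: riesz_kernel_ge0.
  - apply: emeasurable_funD => //; apply: measurable_funeM.
    by apply/measurable_EFinP; apply: measurable_indic; exact: borel_ball.
  - move=> u _; rewrite indicE; have [uv|uv] := ltP (mdist (u : X) v) (2 * d)%R; last first.
      rewrite memNset; last by rewrite ballEmdist /= metric_sym ltNge uv.
      by rewrite mule0 add0e !max_l// (le_trans _ uv)//; lra.
    rewrite mem_set; last by rewrite ballEmdist /= metric_sym.
    rewrite mule1 (_ : (_ `^ _)%:E = riesz_kernel alpha d); last first.
      by rewrite riesz_kernelE// alpha_gt0.
    rewrite -[leLHS]adde0 leeD ?riesz_kernel_ge0//.
    by apply: riesz_kernel_le; rewrite ltW//= le_max lexx orbT.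
rewrite ge0_integralD//; last 3 first.
- by move=> u _; rewrite mule_ge0 ?lee_fin ?powR_ge0.
- apply: measurable_funeM.
  by apply/measurable_EFinP; apply: measurable_indic; exact: borel_ball.
- by move=> u _; exact: riesz_kernel_ge0.
apply: leeD => //; rewrite ge0_integralZl_EFin ?powR_ge0//; last first.
  by apply/measurable_EFinP; apply: measurable_indic; exact: borel_ball.
rewrite integral_indic//; last exact: borel_ball.
rewrite setIT; apply: le_trans (lee_wpmul2l _ (mu_ball v dd0)) _.
  by rewrite lee_fin powR_ge0.
rewrite -EFinM lee_fin powRM ?(ltW d0)// opprB.
rewrite powRD; last by rewrite (gt_eqF d0) implybT.
by rewrite le_eqVlt; apply/orP; left; apply/eqP; ring.
Qed.

Lemma kernel_bound : (gamma <= alpha)%R -> exists2 C : R, (0 < C)%R &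
  forall (v : X) (d : R), (0 <= d)%R ->
    \int[mu]_(u in [set: borel X])
      riesz_kernel alpha (Num.max (mdist (u : X) v) d) <=
    C%:E * riesz_kernel (alpha - gamma) d.
Proof.
move=> ga; pose A := (K * 2 `^ gamma)%R.
have A0 : (0 <= A)%R by rewrite mulr_ge0 ?powR_ge0.
have Ifin v d : (0 < d)%R -> I v d = (fine (I v d))%:E.
  move=> d0; rewrite fineK// ge0_fin_numE.
    by apply: le_lt_trans (I_le v d0) _; rewrite ltry.
  by apply: integral_ge0 => u _; exact: riesz_kernel_ge0.
have J_le v d : (0 < d)%R -> (fine (I v d) <= d `^ (- alpha))%R.
  by move=> d0; rewrite -lee_fin -Ifin// I_le.
have J_double v d : (0 < d)%R -> (fine (I v d) <=
    A * d `^ (- (alpha - gamma)) + fine (I v (2 * d)))%R.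
  move=> d0; rewrite -lee_fin EFinD -!Ifin//; last by rewrite mulr_gt0.
  exact: I_double.
(* At [d = 0] the right-hand side is [+oo], so the recursion is only run for [0 < d]. *)
have kernel0 C v : (0 < C)%R -> I v 0 <= C%:E * riesz_kernel (alpha - gamma) 0.
  by move=> C0; rewrite /riesz_kernel eqxx gt0_muley// leey.
have [g_lt|a_le] := ltP gamma alpha.
  have s0 : (0 < alpha - gamma)%R by rewrite subr_gt0.
  (* The summand 1 keeps the constant positive even if [A = 0]. *)
  set C := (A / (1 - 2 `^ (- (alpha - gamma))) + 1)%R.
  have C0 : (0 < C)%R.
    rewrite ltr_wpDl// divr_ge0// subr_ge0 powRN invf_le1 ?powR_gt0//.
    have : (1 `^ (alpha - gamma) <= (2:R) `^ (alpha - gamma))%R.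
      by apply: ge0_ler_powR; rewrite ?nnegrE; lra.
    by rewrite powR1.
  exists C => // v d; rewrite le_eqVlt => /predU1P[<-|d0].
    by rewrite (kernel0 _ v).
  have := doubling_powR A0 alpha_gt0 (J_le v) s0 (J_double v) d0.
  rewrite riesz_kernelE// s0 -[X in X <= _]/(I v d) Ifin// -EFinM lee_fin => /le_trans; apply.
  by rewrite ler_wpM2r ?powR_ge0// lerDl.
have ag : alpha = gamma by apply/eqP; rewrite eq_le ga a_le.
have ln2 : (0 < ln 2 :> R)%R by apply: ln_gt0; lra.
have Aln0 : (0 <= A / ln 2)%R by rewrite divr_ge0// ltW.
(* For [d <= 1], both terms of [doubling_ln] are absorbed into this multiple of [1 - ln d], because
   [- ln d] is nonnegative. *)
exists (A + 1 + A / ln 2)%R; first by rewrite ltr_wpDr// ltr_wpDl.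
move=> v d; rewrite le_eqVlt => /predU1P[<-|d0].
  by apply: (kernel0 _ v); rewrite ltr_wpDr// ltr_wpDl.
rewrite riesz_kernelE// ag subrr ltxx -ag -[X in X <= _]/(I v d) Ifin// -EFinM lee_fin.
(* For [1 < d] the logarithmic kernel is 1 and the bound [d^(-alpha) <= 1] suffices. *)
have [d1|d1] := leP d 1%R; last first.
  rewrite ln1 subr0 mulr1 (le_trans (J_le v d d0))//.
  suff : (d `^ (- alpha) <= 1)%R by lra.
  rewrite powRN invf_le1 ?powR_gt0//.
  have : (1 `^ alpha <= d `^ alpha)%R.
    by apply: ge0_ler_powR; rewrite ?nnegrE ?(ltW alpha_gt0) ?(ltW d0) ?(ltW d1).
  by rewrite powR1.
have Jv e : (0 < e)%R -> (fine (I v e) <= A + fine (I v (2 * e)))%R.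
  move=> e0; have := J_double v e e0.
  by rewrite ag subrr oppr0 powRr0 mulr1.
have := @doubling_ln _ (fun d => fine (I v d)) A alpha A0 alpha_gt0 (J_le v) d Jv.
rewrite d0 d1 => /(_ isT) /le_trans; apply.
have : (0 <= - ln d)%R by rewrite oppr_ge0 ln_le0.
move: (ln d) => l l0; nra.
Qed.

End kernel_bound.

(** * Growth and covering estimates from regularity *)

Section regular_measure.
Context {R : realType} (X : pmetricType R) (G : set X) (gamma c : R).
Variable mu : {finite_measure set (borel X) -> \bar R}.
Hypotheses (gamma_gt0 : 0 < gamma) (c_gt0 : 0 < c).

(* The upper bound holds around every center and for every radius, since a ball
   meeting [G] lies in a ball of twice the radius centered in [G]. *)
Lemma regular_ball_le : carried_by mu G ->
  (forall (a : X) (r : R), G a -> 0 < r <= 1 ->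
    (mu (ball a r) <= (c * r `^ gamma)%:E)%E) ->
  exists2 K : R, 0 <= K & forall (v : X) (r : R), 0 < r ->
    (mu (ball v r) <= (K * r `^ gamma)%:E)%E.
Proof.
move=> [N [mN N0 GN]] muG; pose M := fine (mu [set: borel X]).
have M0 : 0 <= M by apply: fine_ge0.
(* [c] serves for [2 * r <= 1], the total mass [M] for larger radii, and [2^gamma] pays for doubling
   the radius. *)
exists ((c + M) * 2 `^ gamma); first by rewrite mulr_ge0 ?powR_ge0// addr_ge0// ltW.
move=> v r r0; rewrite -mulrA -powRM//; last exact: ltW.
have p0 := powR_ge0 (2 * r) gamma.
have [r2|r2] := leP (2 * r) 1; last first.
  apply: (@le_trans _ _ (mu [set: borel X])).
    by apply: le_measure; rewrite ?inE//; exact: borel_ball.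
  rewrite -[leLHS]fineK ?fin_num_measure// -/M lee_fin.
  have : 1 `^ gamma <= (2 * r) `^ gamma.
    by apply: ge0_ler_powR; rewrite ?nnegrE ?(ltW gamma_gt0) ?(ltW r2)//; lra.
  by rewrite powR1 => p1; rewrite (le_trans (ler_peMr M0 p1))// ler_wpM2r// lerDr ltW.
have [[a [va Ga]]|vG] := pselect (exists a, ball v r a /\ G a).
  apply: (@le_trans _ _ (mu (ball a (2 * r)))).
    apply: le_measure; rewrite ?inE; [exact: borel_ball..|move=> u vu].
    rewrite mulr_natl mulr2n.
    by apply: ball_triangle vu; exact: ball_sym.
  apply: le_trans (muG _ _ Ga _) _; first by rewrite mulr_gt0.
  by rewrite lee_fin ler_wpM2r// lerDl.
(* A ball that misses [G] lies in the null set [N]. *)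
apply: (@le_trans _ _ 0%E); last by rewrite lee_fin mulr_ge0// addr_ge0// ltW.
rewrite -N0; apply: le_measure; rewrite ?inE//; first exact: borel_ball.
by move=> u vu; apply: GN => Gu; apply: vG; exists u.
Qed.

(** Balls of radius [r / 2] around [r]-separated points are disjoint, so their masses add up. *)
Lemma packing_mass (r m : R) (s : seq X) :
  pairwise (fun x y => r <= mdist x y) s ->
  (forall x, x \in s -> (m%:E <= mu (ball x (r / 2)))%E) ->
  (((size s)%:R * m)%:E <= mu (\big[setU/set0]_(x <- s) ball x (r / 2)))%E.
Proof.
elim: s => [|x s IHs]; first by rewrite mul0r big_nil measure0.
rewrite pairwise_cons => /andP[/allP/= xs ss] ms.
rewrite big_cons measureU; last 3 first.
- exact: borel_ball.
- by apply: bigsetU_measurable => y _; exact: borel_ball.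
- rewrite -subset0 => u [xu]; rewrite -bigcup_seq => -[y /= ys yu].
  have := xs y ys; rewrite leNgt => /negP; apply.
  have : ball x (r / 2 + r / 2) y by apply: ball_triangle xu _; exact: ball_sym.
  by rewrite -splitr ballEmdist.
rewrite -natr1 mulrDl mul1r EFinD addeC leeD//.
  by apply: ms; rewrite mem_head.
by apply: IHs => // y ys; apply: ms; rewrite inE ys orbT.
Qed.

(** A maximal [r]-separated family in [G] is an [r]-net, since an uncovered point could be added to
    it. The packing estimate bounds its size. *)
Lemma regular_covering :
  (forall (a : X) (r : R), G a -> 0 < r <= 1 ->
    ((c^-1 * r `^ gamma)%:E <= mu (ball a r))%E) ->
  exists2 C : R, 0 < C & forall r : R, 0 < r <= 1 -> exists s : seq X,
    (size s)%:R <= C * r `^ (- gamma) /\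
    forall u, G u -> exists2 x, x \in s & ball x r u.
Proof.
move=> muG; pose M := fine (mu [set: borel X]).
have M0 : 0 <= M by apply: fine_ge0.
(* Packing yields [M c (r / 2)^(-gamma)]; [M + 1] replaces [M] to have a positive constant. *)
exists ((M + 1) * c * 2 `^ gamma); first by rewrite !mulr_gt0 ?powR_gt0//; lra.
move=> r /andP[r0 r1].
pose sep (s : seq X) := pairwise (fun x y => r <= mdist x y) s.
pose good s := sep s /\ forall x, x \in s -> G x.
have sizele s : good s -> (size s)%:R <= (M + 1) * c * 2 `^ gamma * r `^ (- gamma).
  move=> [seps sG].
  have /(packing_mass seps) : forall x, x \in s ->
      ((c^-1 * (r / 2) `^ gamma)%:E <= mu (ball x (r / 2)))%E.
    by move=> x /sG Gx; apply: muG => //; apply/andP; split; lra.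
  have : (mu (\big[setU/set0]_(x <- s) ball x (r / 2)) <= mu [set: borel X])%E.
    apply: le_measure; rewrite ?inE//.
    by apply: bigsetU_measurable => y _; exact: borel_ball.
  move=> /[swap] /le_trans/[apply].
  rewrite -[leRHS]fineK ?fin_num_measure// -/M lee_fin.
  rewrite mulrA -ler_pdivlMr ?powR_gt0 ?divr_gt0// ler_pdivrMr// => /le_trans; apply.
  rewrite powRM ?invr_ge0 ?(ltW r0)// invfM powRN.
  have -> : (2^-1 : R) `^ gamma = (2 `^ gamma)^-1.
    by rewrite -[2^-1]powR_inv1// -powRrM mulN1r powRN.
  rewrite invrK [leLHS](_ : _ = M * c * 2 `^ gamma / r `^ gamma); last by ring.
  rewrite !ler_wpM2r ?invr_ge0 ?powR_ge0 ?(ltW c_gt0)//.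
  by rewrite lerDl.
pose sizes n := `[< exists2 s, good s & size s = n >].
have ex : exists n, sizes n by exists 0%N; apply/asboolP; exists [::].
have ub n : sizes n -> (n <= Num.truncn ((M + 1) * c * 2 `^ gamma * r `^ (- gamma)))%N.
  by move=> /asboolP[s /sizele + <-] => sle; rewrite truncn_ge_nat // (le_trans _ sle).
case: (ex_maxnP ex ub) => n /asboolP[s [seps sG] <-] smax.
exists s; split => //; first exact: sizele.
move=> u Gu; apply: contrapT => nu.
suff /smax : sizes (size s).+1 by rewrite ltnn.
apply/asboolP; exists (u :: s) => //; split.
  rewrite /sep pairwise_cons; apply/andP; split => //.
  apply/allP => x xs /=; rewrite leNgt; apply/negP => ux; apply: nu.
  by exists x => //; rewrite ballEmdist /= metric_sym.
by move=> x; rewrite inE => /predU1P[->//|/sG].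
Qed.

End regular_measure.

(** * Energy of product measures *)

Section retraction.
Context {R : realType} (X : pmetricType R) (S : set X) (x0 : X).
Hypothesis mS : measurable (S : set (borel X)).

(** With [x0] in [S], every value lies in [S], so the countable net of [S] is available at every
    point and not only almost everywhere. *)
Definition retract (x : X) : X := if x \in S then x else x0.

Lemma measurable_retract : measurable_fun [set: borel X] (retract : borel X -> borel X).
Proof.
apply: measurable_fun_ifT => //.
apply: (measurable_fun_bool true); rewrite setTI.
rewrite (_ : _ @^-1` _ = S)//; apply/seteqP; split => x /=.
  by move=> /set_mem.
by move=> Sx; apply/mem_set.
Qed.

(** The map is the identity on [S], so the preimage of [A] exceeds [A] only inside the null
    complement of [S]. *)
Lemma retract_mass_le (mu : {measure set (borel X) -> \bar R})
    (A : set (borel X)) : mu (~` S) = 0%E -> measurable A ->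
  (mu (retract @^-1` A) <= mu A)%E.
Proof.
move=> S0 mA; rewrite -[leRHS]adde0 -S0.
have mSC : measurable (~` S : set (borel X)) by exact: measurableC.
apply: (le_trans _ (measureU2 mu mA mSC)).
have mrA : measurable (retract @^-1` A : set (borel X)).
  by rewrite -[X in measurable X]setTI; exact: measurable_retract.
apply: le_measure; rewrite ?inE//; first exact: measurableU.
move=> x; rewrite /retract /=; case: ifPn => [_ Ax|/negP xS _]; first by left.
by right => Sx; apply: xS; exact/mem_set.
Qed.

Context (Y : pmetricType R) (a : nat -> X).
Hypothesis aS : forall (x : X) (k : nat), S x -> exists n, ball (a n) k.+1%:R^-1 x.
Hypothesis Sx0 : S x0.

(* An open set [U] of the product meets [S `*` Y] in a countable union of open
   rectangles, so no separability of [Y] is needed. *)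
Lemma measurable_retract_pair : measurable_fun [set: borel X * borel Y]
  ((fun p => (retract p.1, p.2)) : borel X * borel Y -> borel (X * Y)%type).
Proof.
apply: (@measurability _ _ _ (borel (X * Y)%type) _ _ (@open (X * Y)%type)) => //.
move=> _ [U oU <-]; rewrite setTI.
(* [V n k] is the open set of those [y] around which some rectangle with first side the ball at
   [a n] fits in [U]. *)
pose V n k := [set y : Y | exists2 e : R, 0 < e &
  ball (a n) k.+1%:R^-1 `*` ball y e `<=` U].
have oV n k : open (V n k).
  apply: open_ballP => y [e e0 yU]; exists (e / 2); first by rewrite divr_gt0.
  move=> z yz; exists (e / 2); first by rewrite divr_gt0.
  move=> [u w] [/= au zw]; apply: yU; split => //=.
  by rewrite (splitr e); exact: ball_triangle zw.
rewrite (_ : _ @^-1` _ = \bigcup_n \bigcup_k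
    ((retract @^-1` ball (a n) k.+1%:R^-1) `*` V n k)).
  apply: bigcupT_measurable => n; apply: bigcupT_measurable => k.
  apply: measurableX; last exact: borel_open.
  rewrite -[X in measurable X]setTI; apply: measurable_retract => //.
  exact: borel_ball.
have Sr x : S (retract x).
  by rewrite /retract; case: ifPn => // /set_mem.
apply/seteqP; split=> [[x y] /= Uxy|[x y] [n _ [k _ [/= xn [e e0 yU]]]]]; last first.
  by apply: yU; split => //=; exact: ballxx.
have [e e0 xyU] : exists2 e : R, 0 < e & ball (retract x, y) e `<=` U.
  by have : nbhs (retract x, y) U; [exact: open_nbhs_nbhs|rewrite -nbhs_ballE].
(* A net ball of radius below [e / 2] containing [retract x] stays within distance [e] of it. *)
have [k ke] : exists k, k.+1%:R^-1 < e / 2.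
  exists (Num.truncn (e / 2)^-1).
  by rewrite invf_plt ?posrE ?divr_gt0// truncnS_gt.
have [n xn] := aS k (Sr x).
exists n => //; exists k => //; split => //=; exists e => //.
move=> [u w] [/= au yw]; apply: xyU; split => //=.
rewrite (splitr e); apply: (@ball_triangle _ _ (a n)).
  by apply: (le_ball (ltW ke)); exact: ball_sym.
exact: (le_ball (ltW ke)).
Qed.

End retraction.

Lemma countable_net {R : realType} (X : pmetricType R) (G : set X) :
  (forall r : R, 0 < r <= 1 -> exists s : seq X,
    forall u, G u -> exists2 x, x \in s & ball x r u) ->
  exists a : nat -> X, forall (x : X) (k : nat), G x ->
    exists n, ball (a n) k.+1%:R^-1 x.
Proof.
move=> Gs; have k01 (k : nat) : 0 < (k.+1%:R^-1 : R) <= 1.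
  by rewrite invr_gt0 ltr0n/= invf_le1 ?ltr0n// ler1n.
have /choice[s sG] : forall k : nat, exists s : seq X,
  forall u, G u -> exists2 x, x \in s & ball x (k.+1%:R^-1 : R) u.
  by move=> k; exact: Gs (k01 k).
exists (fun n => if unpickle n is Some (k, i) then nth point (s k) i else point).
move=> x k /(sG k)[y ys yx]; exists (pickle (k, index y (s k))).
by rewrite pickleK nth_index.
Qed.

Section product_energy.
Context {R : realType} (X Y : pmetricType R) (G : set X) (H : set Y).
Variables (S : set X) (x0 : X) (a : nat -> X) (P : probability (borel X) R).
Hypothesis mS : measurable (S : set (borel X)).
Hypothesis aS : forall (x : X) (k : nat), S x -> exists n, ball (a n) k.+1%:R^-1 x.
Hypotheses (Sx0 : S x0) (GS : G `<=` S) (PG : carried_by P G).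
Local Open Scope ereal_scope.

Let PS : P (~` S) = 0.
Proof.
have [N [mN N0 GN]] := PG; apply/eqP; rewrite eq_le measure_ge0 andbT -N0.
apply: le_measure; rewrite ?inE//; first exact: measurableC.
by move=> x Sx; apply: GN => /GS.
Qed.

Let f : borel X * borel Y -> borel (X * Y)%type :=
  fun p => (retract S x0 p.1, p.2).
Let fm : {mfun (borel X * borel Y)%type >-> borel (X * Y)%type} := HB.pack f
  (isMeasurableFun.Build _ _ _ _ f (measurable_retract_pair mS aS Sx0)).

Variables (alpha beta C : R).
Hypothesis C_gt0 : (0 < C)%R.
Hypothesis P_kernel : forall (v : X) (d : R), (0 <= d)%R ->
  \int[P]_(u in [set: borel X])
    riesz_kernel alpha (Num.max (mdist (retract S x0 u) v) d) <=
  C%:E * riesz_kernel beta d.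

(** The inner integral over the first coordinate is bounded by [P_kernel] uniformly in [v]; what
    remains is the potential of [nu] at the second coordinate. *)
Lemma product_energy (nu : probability (borel Y) R) : carried_by nu H ->
  exists2 pi : probability (borel (X * Y)%type) R,
    carried_by pi (G `*` H) & energy alpha pi <= C%:E * energy beta nu.
Proof.
move=> nuH.
pose pi : probability (borel (X * Y)%type) R := distribution (P \x nu) fm.
exists pi.
  have retr0 N' : measurable (N' : set (borel X)) -> P N' = 0 ->
      P (retract S x0 @^-1` N') = 0.
    move=> mN' N'0; apply/eqP; rewrite eq_le measure_ge0 andbT -N'0.
    exact: retract_mass_le.
  have [N [mN N0 GN]] := PG; have [M [mM M0 HM]] := nuH.
  (* The cylinders over the two null sets cover the complement of the product set. *)
  pose A : set (borel (X * Y)%type) := (@fst X Y) @^-1` N.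
  pose B : set (borel (X * Y)%type) := (@snd X Y) @^-1` M.
  have mA : measurable A.
    rewrite -[X in measurable X]setTI.
    by apply: (measurable_continuous (f := @fst X Y)) => // ?; exact: cvg_fst.
  have mB : measurable B.
    rewrite -[X in measurable X]setTI.
    by apply: (measurable_continuous (f := @snd X Y)) => // ?; exact: cvg_snd.
  have A0 : pi A = 0.
    rewrite /pi /distribution /pushforward /=.
    rewrite (_ : _ @^-1` _ = (retract S x0 @^-1` N) `*` setT); last first.
      by apply/seteqP; split=> [[x y]|[x y] []] //=.
    rewrite -[RHS](mul0e (nu [set: borel Y])) -(retr0 N mN N0).
    apply: product_measure1E => //.
    by rewrite -[X in measurable X]setTI; exact: measurable_retract.
  have B0 : pi B = 0.
    rewrite /pi /distribution /pushforward /=.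
    rewrite (_ : _ @^-1` _ = setT `*` M); last first.
      by apply/seteqP; split=> [[x y]|[x y] []] //=.
    rewrite -[RHS](mule0 (P [set: borel X])) -M0.
    exact: product_measure1E.
  exists (A `|` B); split; first exact: measurableU.
    apply/eqP; rewrite eq_le measure_ge0 andbT.
    have piU : pi (A `|` B) <= pi A + pi B by exact: measureU2.
    by rewrite (le_trans piU)// A0 B0 adde0.
  move=> [x y] /= xy; have [/GN|/contrapT Gx] := pselect (~ G x); first by left.
  by right; apply: HM => Hy; apply: xy.
pose g (y : borel Y) := \int[nu]_(w in [set: borel Y])
  riesz_kernel beta (mdist (w : Y) (y : Y)).
have mg : measurable_fun [set: borel Y] g by exact: measurable_potential.
have g0 y : 0 <= g y by apply: integral_ge0 => w _; exact: riesz_kernel_ge0.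
have mgsnd : measurable_fun [set: borel (X * Y)%type]
    (fun q : borel (X * Y)%type => g q.2).
  apply: (measurableT_comp mg).
  by apply: (measurable_continuous (f := @snd X Y)) => // ?; exact: cvg_snd.
apply: (@le_trans _ _ (\int[pi]_q (C%:E * g q.2))).
  apply: ge0_le_integral => //.
  - by move=> q _; apply: integral_ge0 => p _; exact: riesz_kernel_ge0.
  - exact: measurable_potential.
  - exact: measurable_funeM.
  move=> [v z] _ /=.
  have mk : measurable_fun [set: borel X * borel Y] (fun p =>
      riesz_kernel alpha (mdist (f p : (X * Y)%type) (v, z))).
    have := measurable_riesz_mdist (X := (X * Y)%type) alpha (v, z) 0.
    under eq_fun do rewrite addr0.
    move=> /measurableT_comp; apply.
    exact: (measurable_retract_pair mS aS Sx0).
  rewrite ge0_integral_distribution//; last 2 first.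
  - have := measurable_riesz_mdist (X := (X * Y)%type) alpha (v, z) 0.
    by under eq_fun do rewrite addr0.
  - by move=> p; exact: riesz_kernel_ge0.
  (* The first coordinate is integrated first, with [d] the distance of the second coordinates. *)
  rewrite fubini_tonelli2//; last by move=> p; exact: riesz_kernel_ge0.
  have mkb : measurable_fun [set: borel Y] (fun w : borel Y =>
      riesz_kernel beta (mdist (w : Y) z)).
    by have := measurable_riesz_mdist beta z 0; under eq_fun do rewrite addr0.
  rewrite /g -ge0_integralZl_EFin ?(ltW C_gt0)//; last first.
    by move=> y _; exact: riesz_kernel_ge0.
  apply: ge0_le_integral => //.
  - by move=> y _; apply: integral_ge0 => x _; exact: riesz_kernel_ge0.
  - by apply: measurable_fun_fubini_tonelli_G => // p; exact: riesz_kernel_ge0.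
  - exact: measurable_funeM.
  - by move=> y _; exact: (P_kernel v (mdist_ge0 (y : Y) z)).
rewrite ge0_integral_distribution//; last 2 first.
- exact: measurable_funeM.
- by move=> q; rewrite mule_ge0// lee_fin ltW.
rewrite fubini_tonelli2//=; last 2 first.
- by apply: measurable_funeM; exact: measurableT_comp.
- by move=> p; rewrite mule_ge0// lee_fin ltW.
(* The integrand depends on the second coordinate only, and [P] has mass 1. *)
rewrite (eq_integral (fun y => C%:E * g y)); last first.
  move=> y _; rewrite /fubini_G -[RHS]mule1 -(probability_setT P).
  by rewrite -integral_cst.
by rewrite ge0_integralZl_EFin// ltW.
Qed.

End product_energy.

(** * From energies to capacities *)

Section capacity_le.
Context {R : realType} (X Y : pmetricType R) (G : set X) (H : set Y).
Variables (alpha beta C : R).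
Hypothesis C_gt0 : 0 < C.
Local Open Scope ereal_scope.

Lemma capacity_le :
  (forall nu : probability (borel Y) R, carried_by nu H ->
    exists2 pi : probability (borel X) R, carried_by pi G &
      energy alpha pi <= C%:E * energy beta nu) ->
  capacity beta H <= C%:E * capacity alpha G.
Proof.
move=> HG.
pose A := [set energy beta nu | nu in
  [set nu : probability (borel Y) R | carried_by nu H]].
pose B := [set energy alpha mu | mu in
  [set mu : probability (borel X) R | carried_by mu G]].
rewrite /capacity -/A -/B.
have energy0 (Z : pmetricType R) b (mu : probability (borel Z) R) : 0 <= energy b mu.
  apply: integral_ge0 => v _; apply: integral_ge0 => u _.
  exact: riesz_kernel_ge0.
have A0 : 0 <= ereal_inf A by apply: le_ereal_inf_tmp => _ [mu _ <-].
have B0 : 0 <= ereal_inf B by apply: le_ereal_inf_tmp => _ [mu _ <-].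
have BA : ereal_inf B <= C%:E * ereal_inf A.
  rewrite -ereal_inf_pZl//; apply: le_ereal_inf_tmp => _ [_ [nu /HG[pi piG pinu] <-] <-].
  by apply: ge_ereal_inf; exists (energy alpha pi) => //; exists pi.
have CA0 : 0 <= C%:E * ereal_inf A by rewrite mule_ge0// lee_fin ltW.
have := BA; rewrite -(lee_pV2 CA0 B0) => /(lee_wpmul2l (ltW C_gt0 : 0 <= C%:E)).
(* It remains to cancel [C] in [C (C x)^-1], including [x = 0], where both sides are [+oo], and
   [x = +oo], where both are 0. *)
apply: le_trans; move: A0; case: (ereal_inf A) => [a| |]// a0.
- have [->|a_neq0] := eqVneq a 0%R.
    by rewrite mule0 inve0 gt0_muley.
  rewrite -EFinM !inver mulf_eq0 (gt_eqF C_gt0) (negbTE a_neq0) /= -EFinM.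
  by rewrite invfM mulrA divff ?mul1r// gt_eqF.
- by rewrite gt0_muley// invey mule0.
Qed.

End capacity_le.

Lemma regular_capacity_le {R : realType} (X Y : pmetricType R) (G : set X)
    (H : set Y) (alpha gamma : R) : 0 < alpha -> 0 < gamma ->
    ahlfors_david_regular gamma G -> gamma <= alpha ->
  exists c : R, 0 < c /\
    (capacity (alpha - gamma) H <= c%:E * capacity alpha (G `*` H))%E.
Proof.
move=> alpha0 gamma0 [mu [c [mu0 muG c0 mub]]] ga.
have [x0 Gx0] : exists x, G x.
  apply: contrapT => /forallNP G0; have [N [mN N0 GN]] := muG.
  have : (mu [set: borel X] <= mu N)%E.
    by apply: le_measure; rewrite ?inE// => x _; apply: GN; exact: G0.
  by rewrite leNgt N0 mu0.
have [C C0 Gcov] := regular_covering c0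
  (fun a r Ga r01 => proj1 (andP (mub a r Ga r01))).
have [K K0 muK] := regular_ball_le gamma0 c0 muG
  (fun a r Ga r01 => proj2 (andP (mub a r Ga r01))).
have [a aG] : exists a : nat -> X, forall (x : X) (k : nat), G x ->
    exists n, ball (a n) (k.+1%:R^-1 : R) x.
  by apply: countable_net => r /Gcov[s [_ sG]]; exists s.
(* [S] is a Borel set containing [G] and still approximated by the net [a] at every scale. *)
pose S : set X := \bigcap_k \bigcup_n ball (a n) (k.+1%:R^-1 : R).
have mS : measurable (S : set (borel X)).
  apply: bigcapT_measurable => k; apply: bigcupT_measurable => n.
  exact: borel_ball.
have GS : G `<=` S.
  by move=> x Gx k _; have [n ?] := aG x k Gx; exists n.
have aS (x : X) (k : nat) : S x -> exists n, ball (a n) (k.+1%:R^-1 : R) x.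
  by move=> /(_ k Logic.I)[n _ ?]; exists n.
pose M := fine (mu [set: borel X]).
have M0 : 0 < M by rewrite fine_gt0// mu0 -ge0_fin_numE ?fin_num_measure.
(* [dirac point] is the fallback for mass 0 or [+oo], excluded here since [mu] is nonzero and
   finite. *)
pose P : probability (borel X) R := mnormalize mu (dirac point).
have PE A : P A = (mu A * M^-1%:E)%E.
  by rewrite /P /= /mnormalize gt_eqF//= lt_eqF// -ge0_fin_numE ?fin_num_measure.
have PG : carried_by P G.
  by have [N [mN N0 GN]] := muG; exists N; split=> //; rewrite [LHS]PE N0 mul0e.
have PS : P (~` S) = 0%E.
  have [N [mN N0 GN]] := PG; apply/eqP; rewrite eq_le measure_ge0 andbT -N0.
  apply: le_measure; rewrite ?inE//; first exact: measurableC.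
  by move=> x Sx; apply: GN => /GS.
pose h : borel X -> borel X := retract S x0.
have mh : measurable_fun [set: borel X] h := measurable_retract x0 mS.
pose hm : {mfun borel X >-> borel X} := HB.pack h (isMeasurableFun.Build _ _ _ _ h mh).
(* The kernel bound is proved for the image of [P], whose balls are no heavier, and pulled back by
   change of variables. *)
pose P' : probability (borel X) R := distribution P hm.
have P'K (v : X) (r : R) : 0 < r -> (P' (ball v r) <= (K / M * r `^ gamma)%:E)%E.
  move=> r0; apply: (@le_trans _ _ (P (ball v r))).
    exact: (retract_mass_le x0 mS PS (borel_ball v r)).
  rewrite PE mulrAC EFinM lee_wpmul2r ?lee_fin ?invr_ge0 ?(ltW M0)//.
  exact: muK.
have KM0 : 0 <= K / M by rewrite divr_ge0// ltW.
have [c' c'0 ker] := kernel_bound alpha0 KM0 P'K ga.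
exists c'; split => //; apply: (capacity_le c'0) => nu nuH.
apply: (product_energy mS aS (GS _ Gx0) GS PG c'0 _ nuH) => v d d0.
have := ker v d d0; rewrite ge0_integral_distribution//.
  apply: (measurableT_comp (measurable_riesz_kernel alpha)).
  by apply: measurable_maxr => //; exact: measurable_mdistr.
by move=> u; exact: riesz_kernel_ge0.
Qed.

(** * Hausdorff measures of products *)

Section hausdorff_product.
Context {R : realType} (X Y : pmetricType R) (G : set X) (H : set Y).
Variables (alpha gamma C : R).
Hypotheses (alpha_gt0 : 0 < alpha) (C_gt0 : 0 < C).
Hypothesis G_cover : forall r : R, 0 < r <= 1 -> exists s : seq X,
  (size s)%:R <= C * r `^ (- gamma) /\
  forall u, G u -> exists2 x, x \in s & ball x r u.

(** Each ball of radius [r] covering part of [H] becomes at most [C r^(-gamma)] product balls, of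
    total cost at most [C r^(-gamma) (2 r)^alpha = C 2^gamma (2 r)^(alpha - gamma)]. *)
Lemma hausdorff_content_setX_le (delta : R) : 0 < delta <= 1 ->
  (hausdorff_content alpha delta (G `*` H) <=
   (C * 2 `^ gamma)%:E * hausdorff_content (alpha - gamma) delta H)%E.
Proof.
move=> /andP[delta0 delta1]; rewrite /hausdorff_content.
have D0 : 0 < C * 2 `^ gamma by rewrite mulr_gt0 ?powR_gt0.
rewrite -ereal_inf_pZl//.
apply: le_ereal_inf_tmp => _ [_ [b [r [r_delta Hb ->]]] <-].
have /choice[s sP] : forall n, exists s : seq X,
    (forall u, G u -> 0 < r n -> exists2 x, x \in s & ball x (r n) u) /\
    (size s)%:R * (2 * r n) `^ alpha <=
      C * 2 `^ gamma * (2 * r n) `^ (alpha - gamma).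
  move=> n; have /andP[r0 rd] := r_delta n.
  (* A ball of radius 0 is empty and needs no product ball. *)
  have [rn0|rn0] := ltP 0 (r n); last first.
    by exists [::]; split => //; rewrite mul0r mulr_ge0 ?powR_ge0// ltW.
  have [s [size_s sG]] : exists s : seq X, (size s)%:R <= C * r n `^ (- gamma) /\
      forall u, G u -> exists2 x, x \in s & ball x (r n) u.
    by apply: G_cover; rewrite rn0 (le_trans rd).
  exists s; split=> [u Gu _|]; first exact: sG.
  have p0 : 2 * r n != 0 by rewrite mulf_neq0// gt_eqF.
  apply: le_trans (ler_wpM2r (powR_ge0 _ _) size_s) _.
  rewrite powRD ?p0 ?implybT// [(2 * r n) `^ (- gamma)]powRM ?(ltW rn0)//.
  rewrite (powRN 2) le_eqVlt; apply/orP; left; apply/eqP; field.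
  by rewrite gt_eqF// powR_gt0.
(* The doubly indexed cover is listed by codes of pairs; a code naming no ball gets radius 0 and
   costs nothing because [0 < alpha]. [pickle_inv] accepts exact codes only, so no ball is counted
   twice. *)
pose ball_at m : option (nat * nat) := if pickle_inv m is Some (n, i) then
  if (i < size (s n))%N then Some (n, i) else None else None.
pose c m : X * Y := if ball_at m is Some (n, i)
  then (nth point (s n) i, b n) else point.
pose rho m : R := if ball_at m is Some (n, i) then r n else 0.
have ball_atE n i : (i < size (s n))%N -> ball_at (pickle (n, i)) = Some (n, i).
  by move=> i_s; rewrite /ball_at pickleK_inv i_s.
apply: ge_ereal_inf; exists (\sum_(m <oo) ((2 * rho m) `^ alpha)%:E)%E.
  exists c, rho; split=> //.
    by move=> m; rewrite /rho; case: (ball_at m) => [[]//|]; rewrite lexx ltW.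
  move=> [u y] [/= Gu /Hb[n _ ny]].
  have rn0 : 0 < r n.
    by move: ny; rewrite ballEmdist /=; apply: le_lt_trans; exact: mdist_ge0.
  have [x xs xu] := (sP n).1 u Gu rn0.
  exists (pickle (n, index x (s n))) => //.
  by rewrite /c /rho ball_atE ?index_mem// nth_index.
(* Nonnegative terms may be regrouped: the sum over codes becomes a sum over [J], then an iterated
   sum over [n] and [i]. *)
pose J := [set: nat] `*`` (fun n => `I_(size (s n))).
rewrite nneseries_esumT; last by move=> m; rewrite lee_fin powR_ge0.
rewrite (_ : esum _ _ = \esum_(m in pickle @` J) ((2 * rho m) `^ alpha)%:E)%E; last first.
  rewrite [RHS]esum_mkcond; apply: eq_esum => m _.
  case: ifPn => // /negP mJ; rewrite /rho /ball_at.
  case um : (pickle_inv m : option (nat * nat)) => [[n i]|]; last by rewrite mulr0 powR0// gt_eqF.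
  case: ifPn => i_s; last by rewrite mulr0 powR0// gt_eqF.
  exfalso; apply: mJ; apply/mem_set; exists (n, i) => //.
  by have := @pickle_invK (nat * nat)%type m; rewrite um.
rewrite esum_image; last by move=> p q _ _; exact: (pcan_inj pickleK).
rewrite (_ : esum _ _ = \esum_(p in J) ((2 * r p.1) `^ alpha)%:E)%E; last first.
  by apply: eq_esum => -[n i] [/= _ i_s]; rewrite /rho ball_atE.
rewrite -(esum_esum (a := fun n _ => ((2 * r n) `^ alpha)%:E)); last first.
  by move=> n i _ _; rewrite lee_fin powR_ge0.
rewrite -nneseries_esumT; last first.
  by move=> n; apply: esum_ge0 => i _; rewrite lee_fin powR_ge0.
rewrite -nneseriesZl; last by move=> n _; rewrite lee_fin powR_ge0.
apply: lee_nneseries => [n _ _|n _].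
  by apply: esum_ge0 => i _; rewrite lee_fin powR_ge0.
rewrite esum_fset; [|exact: finite_II|by move=> i _; rewrite lee_fin powR_ge0].
rewrite -fsbig_ord sumEFin lee_fin sumr_const card_ord -[leLHS]mulr_natl.
exact: (sP n).2.
Qed.

Lemma hausdorff_measure_setX_le :
  (hausdorff_measure alpha (G `*` H) <=
   (C * 2 `^ gamma)%:E * hausdorff_measure (alpha - gamma) H)%E.
Proof.
have cvgH := hausdorff_content_cvg (beta := alpha - gamma) (G := H).
rewrite /hausdorff_measure.
rewrite -(cvg_lim _ (cvgeZl _ cvgH))//.
apply: lee_lim; first exact: hausdorff_content_cvg.
  by apply: is_cvgeZl.
near=> d; apply: hausdorff_content_setX_le; apply/andP; split => //.
near: d; exact: nbhs_right_le.
Unshelve. all: by end_near. Qed.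

End hausdorff_product.

(** * Invariance under exchange of the factors *)

Section swap.
Context {R : realType} (X Y : pmetricType R) (G : set X) (H : set Y).

Lemma mdist_swap (p q : X * Y) : mdist (swap_pair p) (swap_pair q) = mdist p q.
Proof. by rewrite !mdist_prodE maxC. Qed.

Lemma hausdorff_measure_swap (alpha : R) :
  (hausdorff_measure alpha (H `*` G) <= hausdorff_measure alpha (G `*` H))%E.
Proof.
apply: lee_lim; [exact: hausdorff_content_cvg..|].
apply: nearW => d; apply: ereal_inf_le_tmp => _ [a [r [rd Ga ->]]].
exists (fun n => swap_pair (a n)), r; split => //.
move=> [y x] [/= Hy Gx]; have [|n _ [/= ax ay]] := Ga (x, y); first by [].
by exists n.
Qed.

(** The swap is an isometry, so image measures keep their energy; the factor 1 matches the form of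
    [capacity_le]. *)
Lemma capacity_swap (alpha : R) :
  (capacity alpha (G `*` H) <= 1%:E * capacity alpha (H `*` G))%E.
Proof.
apply: capacity_le => // nu nuGH.
have cswap (A B : pmetricType R) : continuous (@swap_pair A B).
  exact: (@swap_continuous A B).
have mswap (A B : pmetricType R) : measurable_fun [set: borel (A * B)%type]
   (@swap_pair A B : borel (A * B)%type -> borel (B * A)%type).
  exact: measurable_continuous (cswap A B).
pose F : {mfun borel (X * Y)%type >-> borel (Y * X)%type} :=
  HB.pack (@swap_pair X Y : borel (X * Y)%type -> borel (Y * X)%type)
    (isMeasurableFun.Build _ _ _ _ _ (mswap X Y)).
exists (distribution nu F).
  have [N [mN N0 GN]] := nuGH.
  exists (@swap_pair Y X @^-1` N); split.
  - by rewrite -[_ @^-1` _]setTI; exact: (mswap Y X).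
  - by rewrite -N0 /distribution /pushforward; congr (nu _); apply/seteqP; split=> -[].
  - by move=> [y x] /= yx; apply: GN => -[/= ? ?]; apply: yx.
rewrite mul1e /energy ge0_integral_distribution//; last 2 first.
- exact: measurable_potential.
- by move=> q; apply: integral_ge0 => p _; exact: riesz_kernel_ge0.
rewrite le_eqVlt; apply/orP; left; apply/eqP; apply: eq_integral => q _ /=.
rewrite ge0_integral_distribution//; last 2 first.
- have := measurable_riesz_mdist alpha (swap_pair q) 0.
  by under eq_fun do rewrite addr0.
- by move=> p; exact: riesz_kernel_ge0.
by apply: eq_integral => p _ /=; rewrite -(mdist_swap p).
Qed.

End swap.

Lemma regular_hausdorff_le {R : realType} (X Y : pmetricType R) (G : set X)
    (H : set Y) (alpha gamma : R) : 0 < alpha ->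
    ahlfors_david_regular gamma G ->
  exists c : R, 0 < c /\
    (hausdorff_measure alpha (G `*` H) <=
     c%:E * hausdorff_measure (alpha - gamma) H)%E.
Proof.
move=> alpha0 [mu [c [_ _ c0 mub]]].
have [C C0 Gcov] := regular_covering c0
  (fun a r Ga r01 => proj1 (andP (mub a r Ga r01))).
exists (C * 2 `^ gamma); split; first by rewrite mulr_gt0 ?powR_gt0.
exact: hausdorff_measure_setX_le.
Qed.

Theorem proposition2p6 (R : realType) (X1 X2 : pmetricType R)
    (G1 : set X1) (G2 : set X2) (alpha : R) (alpha_gt0 : 0 < alpha) :
  (forall gamma1 : R, 0 < gamma1 -> ahlfors_david_regular gamma1 G1 ->
    (gamma1 <= alpha -> exists c7 : R, 0 < c7 /\
      (capacity (alpha - gamma1) G2 <= c7%:E * capacity alpha (G1 `*` G2))%E) /\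
    (gamma1 < alpha -> exists c8 : R, 0 < c8 /\
      (hausdorff_measure alpha (G1 `*` G2) <=
       c8%:E * hausdorff_measure (alpha - gamma1) G2)%E)) /\
  (forall gamma2 : R, 0 < gamma2 -> ahlfors_david_regular gamma2 G2 ->
    (gamma2 <= alpha -> exists c9 : R, 0 < c9 /\
      (capacity (alpha - gamma2) G1 <= c9%:E * capacity alpha (G1 `*` G2))%E) /\
    (gamma2 < alpha -> exists c10 : R, 0 < c10 /\
      (hausdorff_measure alpha (G1 `*` G2) <=
       c10%:E * hausdorff_measure (alpha - gamma2) G1)%E)).
Proof.
split=> gamma gamma0 Greg; split=> [ga|ga].
- exact: regular_capacity_le Greg ga.
- exact: regular_hausdorff_le.
(* The estimate is applied with the regular factor first and carried back by the swap. *)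
- have [c [c0 cap]] := regular_capacity_le G1 alpha_gt0 gamma0 Greg ga.
  exists c; split=> //; apply: (le_trans cap).
  rewrite lee_wpmul2l ?lee_fin ?(ltW c0)//.
  by have := capacity_swap G2 G1 alpha; rewrite mul1e.
- have [c [c0 haus]] := regular_hausdorff_le G1 alpha_gt0 Greg.
  exists c; split=> //; apply: (le_trans _ haus).
  exact: hausdorff_measure_swap.
Qed.
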